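(* For any $\sigma\in[\frac12,1]$, $$\lim_{\sigma'\uparrow\sigma}\mathrm{OneMinM}_{\sigma'}\ \le\ \lim_{k\to\infty}k\text{-}\mathrm{OneMinM}_\sigma\ \le\ \mathrm{OneMinM}_\sigma,$$ where the first limit is over $\sigma'\in[\frac12,\sigma)$ (for $\sigma=\frac12$ only the second inequality is asserted).
   Context: $O=(0,0)$, $|\cdot|$ is the Euclidean norm, $B_\tau(q)\subseteq\mathbb R^2$ is the open disk of radius $\tau$ centered at $q$, and $B_0(q):=\emptyset$. For $P\subseteq\mathbb R^2$ let $\mathcal R(P)$ be the set of functions $r:P\to[0,1]$ such that $r(p)>0$ for at most finitely many $p\in P$ and $B_{r(p)}(p)\cap B_{r(p')}(p')=\emptyset$ for all distinct $p,p'\in P$. For $r\in\mathcal R(P)$ set $U(P,r):=\bigcup_{p\in P}B_{r(p)}(p)$ and $R(P,r):=\inf\{R>0: B_R(O)\supset U(P,r)\}$, with the convention $\mathrm{diam}(U(P,r))=R(P,r)=0$ if $r\equiv0$. For $\sigma\in[\frac12,1]$ define $$F_\sigma(P,r):=\sum_{p\in P}r(p)-\tfrac1{2\sigma}\min\{\mathrm{diam}(U(P,r)),\tfrac12+R(P,r)\},\qquad M_\sigma(P):=\sup\{F_\sigma(P,r): r\in\mathcal R(P)\}\in[0,+\infty].$$ For $p\in\mathbb R^2$, $0<r\le1$, $\Delta_\sigma(p,r)$ is the set of pairs $(q_1,q_2)\in\overline{B_r(p)}\times\overline{B_r(p)}$ with $|q_1-q_2|\ge2\sigma r$. For $L>1$,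 a set $P\subseteq\mathbb R^2$ is $(\sigma,L)$-one-stable if for every $p\in P\cap B_L(O)$ there is $(q_1,q_2)\in\Delta_\sigma(p,1)$ with $q_1,q_2\in P$. Set $$\mathrm{OneMinM}_\sigma(L):=\inf\{M_\sigma(P):P\text{ is }(\sigma,L)\text{-one-stable and }O\in P\},\qquad \mathrm{OneMinM}_\sigma:=\lim_{L\to\infty}\mathrm{OneMinM}_\sigma(L),$$ the limit existing by monotonicity in $L$. Define families of finite sets by $\mathcal F_\sigma(0):=\{\{O\}\}$ and $$\mathcal F_\sigma(k+1):=\Big\{P\cup\bigcup_{p\in P}\{q_{p,1},q_{p,2}\}: P\in\mathcal F_\sigma(k),\ (q_{p,1},q_{p,2})\in\Delta_\sigma(p,1)\text{ for all }p\in P\Big\},$$ and set $k\text{-}\mathrm{OneMinM}_\sigma:=\inf_{P\in\mathcal F_\sigma(k)}M_\sigma(P)$ for integers $k\ge 0$. The quantity $k\text{-}\mathrm{OneMinM}_\sigma$ is nondecreasing in $k$ and in $\sigma$, and $\mathrm{OneMinM}_\sigma$ is nondecreasing in $\sigma$. *)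

(* Defs.v *)
From HB Require Import structures.
From mathcomp Require Import all_boot all_order all_algebra.
From mathcomp Require Import all_classical all_reals all_analysis.
Set Implicit Arguments.
Unset Strict Implicit.
Unset Printing Implicit Defensive.
Import Order.TTheory GRing.Theory Num.Theory.
Import numFieldNormedType.Exports.
Local Open Scope classical_set_scope.
Local Open Scope ring_scope.

Section Definitions.
Context {R : realType}.
Local Notation plane := (R * R)%type.
Implicit Types (sigma L tau : R) (p q : plane) (P : set plane)
  (r : plane -> R) (k : nat).

(* The library norm on [R * R] is the sup norm. *)
Definition enorm p : R := Num.sqrt (p.1 ^+ 2 + p.2 ^+ 2).

(* Empty when [tau = 0]. *)
Definition disk tau q : set plane := [set x | enorm (x - q) < tau].

Definition cdisk tau q : set plane := [set x | enorm (x - q) <= tau].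

(* As [sup set0 = 0], the empty set has diameter 0. *)
Definition diam (A : set plane) : R :=
  sup [set enorm (z.1 - z.2) | z in A `*` A].

(* A radius function on [P] is a total function whose values off [P] are never
   used. *)
Definition radii P : set (plane -> R) :=
  [set r | [/\ forall p, P p -> 0 <= r p <= 1,
               finite_set [set p | P p /\ 0 < r p] &
               forall p p', P p -> P p' -> p <> p' ->
                 disk (r p) p `&` disk (r p') p' = set0]].

Definition diskU P r : set plane := \bigcup_(p in P) disk (r p) p.

(* When [diskU P r = set0] this is [inf `]0, +oo[ = 0]. *)
Definition outer_radius P r : R :=
  inf [set rho | 0 < rho /\ diskU P r `<=` disk rho 0].

Definition Fsigma sigma P r : R :=
  \sum_(p \in P) r p
  - (2 * sigma)^-1 *
      Num.min (diam (diskU P r)) (2^-1 + outer_radius P r).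

Definition Msigma sigma P : \bar R :=
  ereal_sup [set (Fsigma sigma P r)%:E | r in radii P].

Definition Delta sigma p tau : set (plane * plane) :=
  [set q | [/\ cdisk tau p q.1, cdisk tau p q.2 &
               2 * sigma * tau <= enorm (q.1 - q.2)]].

Definition one_stable sigma L P : Prop :=
  forall p, P p -> disk L 0 p ->
    exists q : plane * plane, [/\ Delta sigma p 1 q, P q.1 & P q.2].

Definition OneMinML sigma L : \bar R :=
  ereal_inf [set Msigma sigma P | P in [set P | one_stable sigma L P /\ P 0]].

Definition OneMinM sigma : \bar R := lim (OneMinML sigma L @[L --> +oo]).

Fixpoint family sigma k : set (set plane) :=
  if k is k'.+1 then
    [set Q | exists P (q : plane -> plane * plane),
       [/\ family sigma k' P, forall p, P p -> Delta sigma p 1 (q p) &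
           Q = P `|` \bigcup_(p in P) [set (q p).1; (q p).2]]]
  else [set [set 0]].

Definition kOneMinM sigma k : \bar R :=
  ereal_inf [set Msigma sigma P | P in family sigma k].

(* [lim] is only meaningful when the limit exists; for [0 < sigma] the three
   limits [L --> +oo], [s --> sigma^'-] and [k --> \oo] do, by monotonicity. *)

Lemma diam_ge0 (A : set plane) : 0 <= diam A.
Proof.
rewrite /diam; set A' := [set _ | _ in _].
have [supA|/sup_out->//] := pselect (has_sup A').
have [[_ [z Az _]] ubA] := supA.
apply: (@le_trans _ _ (enorm (z.1 - z.2))); first exact: sqrtr_ge0.
by apply: ub_le_sup => //; exists z.
Qed.

Lemma outer_radius_ge0 P r : 0 <= outer_radius P r.
Proof.
rewrite /outer_radius; set A := [set _ | _].
have [->|/set0P A0] := eqVneq A set0; first by rewrite inf0.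
by apply: lb_le_inf => // x [/ltW].
Qed.

Lemma Fsigma_le sigma sigma' P r : 0 < sigma -> sigma <= sigma' ->
  Fsigma sigma P r <= Fsigma sigma' P r.
Proof.
move=> s0 ss'; rewrite lerB// ler_wpM2r//.
  by rewrite le_min diam_ge0/= addr_ge0// outer_radius_ge0.
have s'0 : 0 < sigma' by exact: lt_le_trans ss'.
by rewrite lef_pV2 ?posrE ?mulr_gt0// ler_pM2l.
Qed.

Lemma disk_le0 tau p : tau <= 0 -> disk tau p = set0.
Proof.
move=> t0; apply/seteqP; split => // x /=.
by rewrite /disk/= ltNge (le_trans t0)// sqrtr_ge0.
Qed.

Lemma Msigma_le sigma sigma' P P' : 0 < sigma -> sigma <= sigma' ->
  P `<=` P' -> (Msigma sigma P <= Msigma sigma' P')%E.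
Proof.
move=> s0 ss' PP'; apply: ge_ereal_sup => _ [r [r01 rfin rdisj] <-].
apply: le_ereal_sup_tmp; exists (Fsigma sigma' P r)%:E; last first.
  by rewrite lee_fin Fsigma_le.
pose r' := patch (fun=> 0) P r.
have r'E p : P p -> r' p = r p by move=> Pp; rewrite /r' patchE mem_set.
have r'0 p : ~ P p -> r' p = 0 by move=> Pp; rewrite /r' patchE memNset.
exists r'.
  split.
  - move=> p _; have [Pp|nPp] := pselect (P p); first by rewrite r'E//; apply: r01.
    by rewrite r'0// lexx ler01.
  - apply: sub_finite_set rfin => p [_].
    by have [Pp|nPp] := pselect (P p); [rewrite r'E|rewrite r'0// ltxx].
  - move=> p q _ _ pq.
    have [Pp|nPp] := pselect (P p); last by rewrite r'0// disk_le0// set0I.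
    have [Pq|nPq] := pselect (P q); last by rewrite (r'0 q)// (@disk_le0 0 q)// setI0.
    by rewrite !r'E//; apply: rdisj.
have UE : diskU P' r' = diskU P r.
  apply/seteqP; split => x [p Pp].
    have [P0|nP0] := pselect (P p); last by rewrite r'0// disk_le0.
    by rewrite r'E// => ?; exists p.
  by move=> xp; exists p; [exact: PP'|rewrite r'E].
congr (_%:E); rewrite /Fsigma /outer_radius UE; congr (_ - _).
rewrite -(@fsbig_widen _ _ _ _ P)//.
  by apply: eq_fsbigr => p; rewrite inE => /r'E.
by move=> p [_ nPp] /=; exact: r'0.
Qed.

Lemma Delta_le sigma sigma' p : sigma <= sigma' ->
  Delta sigma' p 1 `<=` Delta sigma p 1.
Proof.
move=> ss' q [q1 q2 q12]; split => //; apply: le_trans q12.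
by rewrite !mulr1 ler_pM2l.
Qed.

Lemma OneMinML_le sigma sigma' L L' : 0 < sigma -> sigma <= sigma' -> L <= L' ->
  (OneMinML sigma L <= OneMinML sigma' L')%E.
Proof.
move=> s0 ss' LL'; apply: le_ereal_inf_tmp => _ [P [stP P0] <-].
apply: (@le_trans _ _ (Msigma sigma P)); last exact: Msigma_le.
apply: ereal_inf_lbound; exists P => //; split => // p Pp pL.
have [|q [/Delta_le D ? ?]] := stP p Pp; first exact: lt_le_trans pL LL'.
by exists q; split => //; exact: D.
Qed.

Lemma OneMinML_is_cvg sigma : 0 < sigma -> cvg (OneMinML sigma L @[L --> +oo]).
Proof.
by move=> s0; apply: nondecreasing_is_cvge => L L' ?; exact: OneMinML_le.
Qed.

Lemma OneMinM_le sigma sigma' : 0 < sigma -> sigma <= sigma' ->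
  (OneMinM sigma <= OneMinM sigma')%E.
Proof.
move=> s0 ss'.
have nd (s : R) : 0 < s -> {homo OneMinML s : n m / (n <= m)%R >-> (n <= m)%E}.
  by move=> s_gt0 L L' ?; exact: OneMinML_le.
rewrite /OneMinM !(cvg_lim _ (nondecreasing_cvge (nd _ _)))// ?(lt_le_trans s0)//.
apply: ge_ereal_sup => _ [L _ <-]; apply: le_ereal_sup_tmp.
by exists (OneMinML sigma' L) => //; exact: OneMinML_le.
Qed.

Lemma OneMinM_at_left_is_cvg sigma : 0 < sigma ->
  cvg (OneMinM s @[s --> sigma^'-]).
Proof.
move=> s0; apply/cvg_ex; eexists; apply/cvg_at_leftNP.
have := @nonincreasing_at_right_cvge _ (OneMinM \o -%R) (- sigma) (BLeft 0).
apply.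
  by rewrite bnd_simp oppr_lt0.
move=> x y; rewrite !in_itv/= => /andP[_ x0] /andP[_ y0] xy.
by apply: OneMinM_le; rewrite ?oppr_gt0// lerN2.
Qed.

Lemma kOneMinM_le sigma k : 0 < sigma ->
  (kOneMinM sigma k <= kOneMinM sigma k.+1)%E.
Proof.
move=> s0; apply: le_ereal_inf_tmp => _ [Q [P [q [famP qD ->]]] <-].
apply: (@le_trans _ _ (Msigma sigma P)).
  by apply: ereal_inf_lbound; exists P.
exact: Msigma_le.
Qed.

Lemma kOneMinM_is_cvg sigma : 0 < sigma ->
  cvg (kOneMinM sigma k @[k --> \oo]).
Proof.
move=> s0; apply: ereal_nondecreasing_is_cvgn.
by apply/nondecreasing_seqP => k; exact: kOneMinM_le.
Qed.

End Definitions.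

(* Main.v *)
Require Import Defs.
From HB Require Import structures.
From mathcomp Require Import all_boot all_order all_algebra.
From mathcomp Require Import all_classical all_reals all_analysis.
From mathcomp Require Import lra.
Import Order.TTheory GRing.Theory Num.Theory.
Import numFieldNormedType.Exports.
Local Open Scope classical_set_scope.
Local Open Scope ring_scope.

(** Second inequality: inside a [(sigma, L)]-one-stable set containing the
    origin one can grow a member of [family sigma k] as long as [k < L], since
    each generation moves by at most 1; [Msigma] is monotone in the set.

    First inequality: cut a ball into finitely many cells of diameter at most
    [d].  Along the generations of a member of [family sigma k] the set of
    visited cells increases, so for [k] larger than the number of cells some
    generation [Q] visits the same cells as the next one.  Replacing the next
    generation by points of [Q] in the same cells shows that [Q] is one-stable
    in the ball up to an error [d].  Contracting [Q] by [1 + d] turns this into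
    genuine one-stability for [s' < sigma], and does not increase [Msigma] as
    [s'] is smaller than [sigma] by at least the contraction factor. *)

Section Plane.
Context {R : realType}.
Local Notation plane := (R * R)%type.
Implicit Types (x y p q : plane) (c : R) (P Q : set plane).

(** * The Euclidean norm and boundedness of unions of disks *)

Lemma enorm_ge0 x : 0 <= enorm x.
Proof. exact: sqrtr_ge0. Qed.

Lemma enorm0 : enorm (0 : plane) = 0.
Proof. by rewrite /enorm /= expr0n /= addr0 sqrtr0. Qed.

Lemma enormN x : enorm (- x) = enorm x.
Proof. by rewrite /enorm /= !sqrrN. Qed.

Lemma enormB x y : enorm (x - y) = enorm (y - x).
Proof. by rewrite -enormN opprB. Qed.

Lemma enormD x y : enorm (x + y) <= enorm x + enorm y.
Proof.
rewrite -(@ler_pXn2r _ 2) ?nnegrE ?addr_ge0 ?enorm_ge0// sqrrD.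
have sq z : enorm z ^+ 2 = z.1 ^+ 2 + z.2 ^+ 2 :> R.
  by rewrite sqr_sqrtr// addr_ge0// sqr_ge0.
rewrite !sq /= mulr2n.
have : x.1 * y.1 + x.2 * y.2 <= enorm x * enorm y.
  apply: le_trans (ler_norm _) _.
  rewrite -(@ler_pXn2r _ 2) ?nnegrE ?mulr_ge0 ?enorm_ge0//.
  rewrite exprMn !sq real_normK ?num_real//.
  (* By Lagrange's identity this square is the gap in the Cauchy-Schwarz inequality. *)
  have := sqr_ge0 (x.1 * y.2 - x.2 * y.1); nra.
nra.
Qed.

Lemma enorm_triangle x y z : enorm (x - z) <= enorm (x - y) + enorm (y - z).
Proof. by rewrite (_ : x - z = (x - y) + (y - z)) ?enormD// addrA subrK. Qed.

Lemma enormZ c x : 0 <= c -> enorm (c *: x) = c * enorm x.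
Proof.
move=> c0; rewrite /enorm /= /GRing.scale /= !exprMn -mulrDr sqrtrM ?sqr_ge0//.
by rewrite sqrtr_sqr ger0_norm.
Qed.

Lemma enorm_le_norm1 x : enorm x <= `|x.1| + `|x.2|.
Proof.
rewrite -(@ler_pXn2r _ 2) ?nnegrE ?addr_ge0 ?enorm_ge0//.
rewrite sqr_sqrtr ?addr_ge0 ?sqr_ge0// sqrrD !real_normK ?num_real//.
by rewrite lerD2r lerDl mulrn_wge0// mulr_ge0.
Qed.

Lemma norm_fst_le_enorm x : `|x.1| <= enorm x.
Proof. by rewrite -sqrtr_sqr ler_wsqrtr// lerDl sqr_ge0. Qed.

Lemma norm_snd_le_enorm x : `|x.2| <= enorm x.
Proof. by rewrite -sqrtr_sqr ler_wsqrtr// lerDr sqr_ge0. Qed.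

(** Only finitely many disks are nonempty, each of radius at most 1. Boundedness keeps the [sup] in
    [diam] and the [inf] in [outer_radius] away from their default values. *)
Lemma diskU_bounded P r : radii P r ->
  exists2 rho : R, 0 < rho & diskU P r `<=` disk rho 0.
Proof.
move=> [r01 /finite_seqP[s sE] _].
have s0 : 0 <= \sum_(p <- s) enorm p by apply: sumr_ge0 => p _; exact: enorm_ge0.
exists (\sum_(p <- s) enorm p + 1); first by rewrite ltr_wpDl.
move=> x [p Pp]; rewrite /disk /= subr0 => xp.
have rp : 0 < r p by apply: le_lt_trans xp; exact: enorm_ge0.
have ps : p \in s by have : [set` s] p by rewrite -sE.
have : enorm p <= \sum_(p <- s) enorm p.
  rewrite (big_rem _ ps) /= lerDl; apply: sumr_ge0 => q _; exact: enorm_ge0.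
have := enormD (x - p) p; rewrite subrK.
have /andP[_] := r01 _ Pp.
lra.
Qed.

Lemma le_diam (A : set plane) (rho : R) x y :
  A `<=` disk rho 0 -> A x -> A y -> enorm (x - y) <= diam A.
Proof.
move=> Ab Ax Ay; apply: ub_le_sup; last by exists (x, y).
exists (rho + rho) => _ [[u v] [/= /Ab uA /Ab vA] <-].
move: uA vA; rewrite /disk /= !subr0.
have := enormD u (- v); rewrite enormN; lra.
Qed.

(** * Contraction towards the origin *)

Section Scaling.
Variable c : R.
Hypothesis c01 : 0 < c <= 1.
Let c0 : 0 < c. Proof. by case/andP: c01. Qed.
Let c1 : c <= 1. Proof. by case/andP: c01. Qed.

Lemma disk_scale (tau : R) p :
  [set c *: x | x in disk tau p] `<=` disk tau (c *: p).
Proof.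
move=> _ [x xp <-]; rewrite /disk /= -scalerBr enormZ ?ltW//.
by apply: le_lt_trans xp; rewrite ler_piMl// enorm_ge0.
Qed.

Lemma diskU_scale P (r : plane -> R) :
  [set c *: x | x in diskU P (fun p => r (c *: p))] `<=`
  diskU [set c *: p | p in P] r.
Proof.
move=> _ [x [p Pp xp] <-]; exists (c *: p); first by exists p.
by apply: disk_scale; exists x.
Qed.

Lemma scale_inj : injective (fun p : plane => c *: p).
Proof. by apply: scalerI; rewrite gt_eqF. Qed.

Lemma radii_scale P (r : plane -> R) : radii [set c *: p | p in P] r ->
  radii P (fun p => r (c *: p)).
Proof.
move=> [r01 rfin rdisj]; split=> [p Pp||p p' Pp Pp' pp'].
- by apply: r01; exists p.
- have := @finite_preimage _ _ _ (fun p : plane => c *: p)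
    (fun x y _ _ => @scale_inj x y) rfin.
  by apply: sub_finite_set => p [Pp rp]; split => //; exists p.
- apply: contrapT => /eqP/set0P[x [xp xp']].
  have imP q : P q -> [set c *: p | p in P] (c *: q) by move=> Pq; exists q.
  have : (disk (r (c *: p)) (c *: p) `&` disk (r (c *: p')) (c *: p')) (c *: x).
    by split; apply: disk_scale; exists x.
  by rewrite rdisj; [|exact: imP|exact: imP|move=> /scale_inj].
Qed.

(* Pull the radii back to [P] unchanged: the disks shrink relative to the
   centers, and [diskU P] scaled by [c] is contained in the union over [c P]. *)
Lemma Msigma_scale (s s' : R) P : 0 < s' -> s' <= s * c ->
  (Msigma s' [set c *: p | p in P] <= Msigma s P)%E.
Proof.
move=> s'0 s's; apply: ge_ereal_sup => _ [r rP <-].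
apply: le_ereal_sup_tmp.
exists (Fsigma s P (fun p => r (c *: p)))%:E.
  by exists (fun p => r (c *: p)) => //; exact: radii_scale.
have [rho rho0 Ub] := diskU_bounded _ _ rP.
have Uc := @diskU_scale P r.
have s0 : 0 < s by rewrite -(pmulr_lgt0 _ c0); exact: lt_le_trans s's.
rewrite lee_fin /Fsigma; apply: lerB.
  by rewrite fsbig_image// => p q _ _; exact: scale_inj.
set U := diskU P _; set V := diskU [set _ | _ in _] _.
have dle : c * diam U <= diam V.
  rewrite mulrC -ler_pdivlMr//.
  have [->|/set0P[u Uu]] := eqVneq U set0.
    by rewrite /diam setX0 image_set0 sup0 divr_ge0 ?diam_ge0 ?ltW.
  apply: ge_sup; first by exists (enorm (u - u)), (u, u).
  move=> _ [[x y] [/= Ux Uy] <-]; rewrite ler_pdivlMr// mulrC.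
  rewrite -(enormZ _ _ (ltW c0)) scalerBr.
  by apply: (le_diam _ _ _ _ Ub); apply: Uc; [exists x|exists y].
have Rle : c * outer_radius P (fun p => r (c *: p))
    <= outer_radius [set c *: p | p in P] r.
  apply: lb_le_inf; first by exists rho.
  move=> t [t0 Vt]; rewrite mulrC -ler_pdivlMr//; apply: ge_inf.
    by exists 0 => z [/ltW].
  split=> [|x Ux]; first by rewrite divr_gt0.
  have : V (c *: x) by apply: Uc; exists x.
  by move/Vt; rewrite /disk /= !subr0 enormZ ?ltW// ltr_pdivlMr// mulrC.
set m := Num.min (diam U) _; set m' := Num.min (diam V) _.
have mle : c * m <= m'.
  rewrite le_min; apply/andP; split.
    by apply: le_trans dle; rewrite ler_pM2l// ge_min lexx.
  apply: (@le_trans _ _ (c * (2^-1 + outer_radius P (fun p => r (c *: p))))).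
    by rewrite ler_pM2l// ge_min lexx orbT.
  (* The summand 1/2 does not scale; [c <= 1] absorbs it. *)
  by rewrite mulrDr lerD// ler_piMl.
have m0 : 0 <= m by rewrite le_min diam_ge0/= addr_ge0// outer_radius_ge0.
(* The factor [c] lost in the minimum is paid for by [s' <= s * c]. *)
have cs : (2 * s)^-1 <= (2 * s')^-1 * c.
  rewrite [leRHS]mulrC ler_pdivlMr ?mulr_gt0// ler_pdivrMl ?mulr_gt0//; lra.
apply: (@le_trans _ _ ((2 * s')^-1 * c * m)); first by rewrite ler_wpM2r.
by rewrite -mulrA ler_pM2l// invr_gt0 mulr_gt0.
Qed.

End Scaling.

(* One-stability with slack [d], required of the points of norm [< B - 1] only,
   so that their witnesses of an exact one-stability lie in the ball of radius
   [B]. *)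
Definition approx_stable (s d B : R) P := forall p, P p -> enorm p < B - 1 ->
  exists q : plane * plane, [/\ P q.1, P q.2,
    enorm (q.1 - p) <= 1 + d, enorm (q.2 - p) <= 1 + d &
    2 * s - 2 * d <= enorm (q.1 - q.2)].

Lemma cdiskE (tau : R) p x : cdisk tau p x = (enorm (x - p) <= tau) :> Prop.
Proof. by []. Qed.

(** The contraction brings witnesses at distance [1 + d] back into the unit disk and turns their
    separation [2 * s - 2 * d] into at least [2 * s']. Points of norm below [L] come from points of
    norm below [(1 + d) * L], whence the radius. *)
Lemma approx_stable_one_stable (s s' d L : R) P : 0 < d -> 0 < L ->
  (1 + d) * s' <= s - d -> approx_stable s d ((1 + d) * L + 1) P ->
  one_stable s' L [set (1 + d)^-1 *: p | p in P].
Proof.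
move=> d0 L0 s's st _ [p Pp <-]; have d1 : 0 < 1 + d by rewrite addr_gt0.
rewrite /disk /= subr0 enormZ ?invr_ge0 ?ltW// ltr_pdivrMl// => pL.
have [|[q1 q2] /= [Pq1 Pq2 q1p q2p q12]] := st _ Pp; first by rewrite addrK.
exists ((1 + d)^-1 *: q1, (1 + d)^-1 *: q2); split; [|by exists q1|by exists q2].
have d1V : 0 <= (1 + d)^-1 by rewrite invr_ge0 ltW.
split; rewrite ?cdiskE /= -scalerBr enormZ//.
- by rewrite ler_pdivrMl// mulr1.
- by rewrite ler_pdivrMl// mulr1.
- rewrite ler_pdivlMl//; nra.
Qed.

(** * Pigeonhole on the cells of a grid *)

Section Cells.
Variables (B d : R).
Hypothesis d0 : 0 < d.
Let n := Num.trunc (2 * B / (d / 2)).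

(** The mesh is [d / 2] because the norm is at most the sum of the two coordinate distances. For
    [|t| <= B] the truncation is at most [n], so [inord] preserves it. *)
Definition cell_coord (t : R) : 'I_n.+1 := inord (Num.trunc ((t + B) / (d / 2))).

Definition cell (x : plane) := (cell_coord x.1, cell_coord x.2).

Lemma cell_coord_eq t u : `|t| <= B -> `|u| <= B ->
  cell_coord t = cell_coord u -> `|t - u| <= d / 2.
Proof.
have d2 : 0 < d / 2 by rewrite divr_gt0.
have bound v : `|v| <= B -> 0 <= (v + B) / (d / 2) <= 2 * B / (d / 2).
  rewrite ler_norml => /andP[v1 v2].
  by rewrite divr_ge0 ?(ltW d2)// ?ler_pM2r ?invr_gt0//; lra.
move=> /bound /andP[t0 tB] /bound /andP[u0 uB] /(congr1 val).
rewrite /= !inordK ?ltnS ?le_truncn// => tu.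
have /andP[t1 t2] := truncn_itv t0; have /andP[u1 u2] := truncn_itv u0.
rewrite tu ler_pdivlMr// in t1.
rewrite tu ltr_pdivrMr// -[X in _ < X * _]natr1 in t2.
rewrite ler_pdivlMr// in u1.
rewrite ltr_pdivrMr// -[X in _ < X * _]natr1 in u2.
by rewrite ler_norml; apply/andP; split; lra.
Qed.

Lemma cell_eq x y : enorm x < B -> enorm y < B -> cell x = cell y ->
  enorm (x - y) <= d.
Proof.
move=> xB yB [/cell_coord_eq e1 /cell_coord_eq e2].
apply: le_trans (enorm_le_norm1 _) _ => /=; rewrite [d]splitr.
by apply: lerD; [apply: e1|apply: e2]; apply: le_trans (ltW _);
  try exact: norm_fst_le_enorm; try exact: norm_snd_le_enorm.
Qed.

Definition cells P : {set 'I_n.+1 * 'I_n.+1} :=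
  [set a | `[< exists p, [/\ P p, enorm p < B & cell p = a] >]]%SET.

Lemma cellsP P a :
  reflect (exists p, [/\ P p, enorm p < B & cell p = a]) (a \in cells P).
Proof. by rewrite finset.in_set; exact: asboolP. Qed.

Lemma cells_sub P Q : P `<=` Q -> cells P \subset cells Q.
Proof.
move=> PQ; apply/fintype.subsetP => a /cellsP[p [/PQ Qp pB pa]].
by apply/cellsP; exists p.
Qed.

(** Induction on [k]: a generation that reaches no new cell makes its predecessor approximately
    stable; otherwise the number of cells grows by at least one. *)
Lemma family_approx_stable_or_cells (s : R) k P : Defs.family s k P ->
  (exists Q, [/\ Q `<=` P, Q 0 & approx_stable s d B Q]) \/
  (P 0 /\ (k <= #|cells P|)%N).
Proof.
elim: k P => [|k IHk] P; first by move=> /= ->; right.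
move=> [Q [q [/IHk fQ qD PE]]].
have QP : Q `<=` P by rewrite PE => ? ?; left.
case: fQ => [[Q' [Q'Q Q'0 Q'st]]|[Q0 kQ]].
  by left; exists Q'; split => //; apply: subset_trans QP.
have [eqc|neqc] := eqVneq (cells P) (cells Q); last first.
  right; split; first exact: QP.
  apply: leq_ltn_trans kQ _; apply: proper_card.
  by rewrite finset.properEneq eq_sym neqc cells_sub.
left; exists Q; split => // p Qp pB.
have [q1 q2 q12] := qD _ Qp.
rewrite !cdiskE in q1 q2.
have near x : P x -> enorm (x - p) <= 1 ->
    exists x', [/\ Q x', enorm (x' - x) <= d & enorm (x' - p) <= 1 + d].
  move=> Px xp.
  (* The margin 1 in [enorm p < B - 1] keeps the witness inside the ball, where its cell is
     counted. *)
  have xB : enorm x < B by have := enormD (x - p) p; rewrite subrK; lra.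
  have : cell x \in cells P by apply/cellsP; exists x.
  rewrite eqc => /cellsP[x' [Qx' x'B /cell_eq x'x]].
  have {}x'x := x'x x'B xB; exists x'; split => //.
  by have := enorm_triangle x' x p; lra.
have Pq1 : P (q p).1 by rewrite PE; right; exists p => //; left.
have Pq2 : P (q p).2 by rewrite PE; right; exists p => //; right.
have [x1 [Qx1 x1q x1p]] := near _ Pq1 q1.
have [x2 [Qx2 x2q x2p]] := near _ Pq2 q2.
exists (x1, x2); split => //=.
(* Moving each of the two witnesses costs at most [d] in separation. *)
have := enorm_triangle (q p).1 x1 (q p).2.
have := enorm_triangle x1 x2 (q p).2.
rewrite [enorm (_ - x1)]enormB; lra.
Qed.

End Cells.

(** * Both inequalities at finite [L] and [k] *)

Lemma OneMinML_le_kOneMinM (s s' L : R) : 0 < s' -> s' < s -> s <= 1 -> 0 < L ->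
  exists k, (OneMinML s' L <= kOneMinM s k)%E.
Proof.
move=> s'0 s's s1 L0.
(* With this [d], the bound [(1 + d) * s' <= s - d] amounts to [s' <= 1]. *)
pose d := (s - s') / 2; have d0 : 0 < d by rewrite divr_gt0// subr_gt0.
have d1 : 0 < 1 + d by rewrite addr_gt0.
have sd : (1 + d) * s' <= s - d by rewrite /d; nra.
pose B := (1 + d) * L + 1.
(* One more than the number of all cells met by the ball, so the counting alternative is impossible,
   whatever [P] is. *)
exists #|cells B d setT|.+1; apply: le_ereal_inf_tmp => _ [P fP <-].
have [[Q [QP Q0 Qst]]|[_]] := family_approx_stable_or_cells B d d0 _ _ _ fP;
  last by rewrite ltnNge subset_leq_card// cells_sub.
apply: (@le_trans _ _ (Msigma s' [set (1 + d)^-1 *: p | p in Q])).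
  apply: ereal_inf_lbound; eexists; last reflexivity; split.
    exact: (approx_stable_one_stable _ _ _ _ _ d0 L0 sd Qst).
  by exists 0 => //; rewrite scaler0.
apply: (@le_trans _ _ (Msigma s Q)); last first.
  by apply: Msigma_le => //; exact: lt_trans s's.
apply: Msigma_scale => //.
  by rewrite invr_gt0 d1 invf_le1// lerDl ltW.
rewrite ler_pdivlMr//; nra.
Qed.

Lemma one_stable_family (s L : R) P k : one_stable s L P -> P 0 -> k%:R < L ->
  exists Q, [/\ Defs.family s k Q, Q `<=` P & forall p, Q p -> enorm p <= k%:R].
Proof.
move=> st P0; elim: k => [|k IHk] kL.
  exists [set 0]; split => //; first by move=> _ ->.
  by move=> _ ->; rewrite enorm0.
have [|Q [fQ QP Qk]] := IHk; first by apply: le_lt_trans kL; rewrite ler_nat.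
(* The norm bound on [Q] places its points in the ball of radius [L], where stability supplies
   witnesses; off [Q] the choice is arbitrary. *)
have /choice[q qP] (p : plane) : exists q : plane * plane,
    Q p -> [/\ Delta s p 1 q, P q.1 & P q.2].
  have [Qp|nQp] := pselect (Q p); last by exists 0.
  have [||q ?] := st p; [exact: QP| |by exists q].
  by rewrite /disk /= subr0 (le_lt_trans (Qk _ Qp))// (le_lt_trans _ kL)// ler_nat.
exists (Q `|` \bigcup_(p in Q) [set (q p).1; (q p).2]); split.
- by exists Q, q; split => // p /qP[].
- by move=> x [/QP//|[p /qP[_ ? ?]] [->|->]].
- move=> x [/Qk xk|[p Qp] xq]; first by apply: le_trans xk _; rewrite ler_nat.
  have [[q1 q2 _] _ _] := qP _ Qp; rewrite !cdiskE in q1 q2.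
  have {q1 q2 xq} : enorm (x - p) <= 1 by case: xq => ->.
  have := enormD (x - p) p; rewrite subrK -natr1.
  have := Qk _ Qp; lra.
Qed.

Lemma kOneMinM_le_OneMinML (s L : R) k : 0 < s -> k%:R < L ->
  (kOneMinM s k <= OneMinML s L)%E.
Proof.
move=> s0 kL; apply: le_ereal_inf_tmp => _ [P [stP P0] <-].
have [Q [fQ QP _]] := one_stable_family _ _ _ _ stP P0 kL.
apply: (@le_trans _ _ (Msigma s Q)); last exact: Msigma_le.
by apply: ereal_inf_lbound; exists Q.
Qed.

End Plane.

Theorem theorem3p1 (R : realType) (sigma : R)
    (hsigma : 2^-1 <= sigma <= 1) :
  (2^-1 < sigma ->
     (lim (OneMinM s @[s --> sigma^'-])
      <= lim (kOneMinM sigma k @[k --> \oo]))%E) /\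
  (lim (kOneMinM sigma k @[k --> \oo]) <= OneMinM sigma)%E.
Proof.
have /andP[s2 s1] := hsigma; have s0 : 0 < sigma by apply: lt_le_trans s2.
split=> [_|].
  apply: cvge_le (OneMinM_at_left_is_cvg s0); near=> s.
  have s'0 : 0 < s by near: s; exact: nbhs_left_gt.
  have s's : s < sigma by near: s; exact: nbhs_left_lt.
  apply: cvge_le (OneMinML_is_cvg s'0); near=> L.
  have L0 : 0 < L by near: L; exact: nbhs_pinfty_gt.
  have [k kL] := OneMinML_le_kOneMinM sigma s L s'0 s's s1 L0.
  apply: le_trans kL _; apply: cvge_ge (kOneMinM_is_cvg s0).
  (* The bound found at one [k] persists by monotonicity in [k]. *)
  exists k => // l /= kl.
  have : nondecreasing_seq (kOneMinM sigma).
    by apply/nondecreasing_seqP => i; exact: kOneMinM_le.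
  by apply.
(* [L] is taken after [k], so eventually [k%:R < L]. *)
apply: cvge_le (kOneMinM_is_cvg s0); near=> k.
apply: cvge_ge (OneMinML_is_cvg s0); near=> L.
by apply: kOneMinM_le_OneMinML.
Unshelve. all: by end_near. Qed.
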